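(* Let $n>1$ be an integer and let $n_0$ be the radical of $n$. Then the following equality of rational functions holds: $$\frac{F_{n_0}(x)}{1-x^{n_0}}=\frac{F_n(x)}{1-x^n}.$$
   Context: For an integer $n>1$, $F_n(x)=\sum_{0\le a\le n-1,\ \gcd(a,n)=1}x^a\in\mathbb{Z}[x]$. The radical of $n$ is the product of the distinct prime divisors of $n$. *)

(* Defs.v *)
From HB Require Import structures.
From mathcomp Require Import all_boot all_order all_algebra.

Set Implicit Arguments.
Unset Strict Implicit.
Unset Printing Implicit Defensive.

Import GRing.Theory.
Local Open Scope ring_scope.

Definition F (n : nat) : {poly int} :=
  \sum_(0 <= a < n | coprime a n) 'X^a.

Definition radical (n : nat) : nat := (\prod_(p <- primes n) p)%N.

(* Main.v *)
Require Import Defs.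
From HB Require Import structures.
From mathcomp Require Import all_boot all_order all_algebra.

Import GRing.Theory.
Local Open Scope ring_scope.

(** The radical of [n] divides [n], and [n] divides a power of its radical, so
    an integer is prime to [n] exactly when it is prime to [radical n].  When
    [r] divides [n] and [n], [r] have the same coprime integers, writing
    [a = k * r + b] with [b < r] turns the condition [coprime a n] into
    [coprime b r]; hence [F n] is the product of [F r] and the geometric sum
    [\sum_(k < n %/ r) 'X^(r * k)], while [1 - 'X^n] is the product of
    [1 - 'X^r] and the same sum ([F_mul], [F_cross]).  The equality of
    fractions is the resulting cross-multiplication. *)

Lemma radical_dvdn n : (0 < n)%N -> (radical n %| n)%N.
Proof.
move=> n_gt0; rewrite [X in (_ %| X)%N](prod_prime_decomp n_gt0).
rewrite prime_decompE big_map /radical big_seq [X in (_ %| X)%N]big_seq.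
apply: (big_ind2 (fun a b => (a %| b)%N)) => // [a b c d|p]; first exact: dvdn_mul.
by rewrite -logn_gt0 => logp; apply: dvdn_exp.
Qed.

Lemma dvdn_radicalX n : (0 < n)%N -> (n %| radical n ^ n)%N.
Proof.
move=> n_gt0; rewrite [X in (X %| _)%N](prod_prime_decomp n_gt0).
rewrite prime_decompE big_map /radical.
rewrite (big_morph (fun m => (m ^ n)%N) (fun a b => expnMn a b n) (exp1n n)).
apply: (big_ind2 (fun a b => (a %| b)%N)) => // [a b c d|p _]; first exact: dvdn_mul.
by apply: dvdn_exp2l; rewrite ltnW // ltn_logl.
Qed.

Lemma coprime_radical a n :
  (0 < n)%N -> coprime a (radical n) = coprime a n.
Proof.
move=> n_gt0; apply/idP/idP => [co_ar|]; last exact: coprime_dvdr (radical_dvdn n n_gt0).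
by apply: coprime_dvdr (dvdn_radicalX n n_gt0) _; apply: coprimeXr.
Qed.

(** Only coprimality to [r], which is [r]-periodic, enters [F (r * m)]; each of
    the [m] blocks of length [r] thus contributes a shifted copy of [F r]. *)
Lemma F_mul r m : (forall a, coprime a (r * m) = coprime a r) ->
  F (r * m) = F r * \sum_(k < m) 'X^r ^+ k.
Proof.
move=> co_rm; rewrite /F (eq_bigl _ _ co_rm) {co_rm}.
elim: m => [|m IHm]; first by rewrite muln0 big_geq // big_ord0 mulr0.
(* Split off the last block [r * m <= a < r * m + r] and shift it to [0 <= a < r]. *)
rewrite big_ord_recr mulrDr -IHm mulnS addnC.
rewrite (@big_cat_nat _ _ _ (r * m)%N) ?leq_addr //=; congr (_ + _).
rewrite -{1}[(r * m)%N]add0n big_addn addKn mulr_suml.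
apply: eq_big => [a|a _]; first by rewrite ![coprime _ r]coprime_sym /coprime addnC mulnC gcdnMDl.
by rewrite exprD exprM.
Qed.

Lemma F_cross r n : (r %| n)%N -> (forall a, coprime a r = coprime a n) ->
  F r * (1 - 'X^n) = F n * (1 - 'X^r).
Proof.
case/dvdnP=> m ->; rewrite mulnC => co_rn; rewrite F_mul => [|a]; last by rewrite co_rn.
by rewrite exprM -[1 - _ ^+ m]opprB subrX1 -mulNr opprB -mulrA [_ * (1 - _)]mulrC.
Qed.

Lemma oneBXn_neq0 (R : nzRingType) n : (0 < n)%N -> 1 - 'X^n != 0 :> {poly R}.
Proof. by move=> n_gt0; rewrite -oppr_eq0 opprB monic_neq0 // monicXnsubC. Qed.

Theorem proposition2p1 (n : nat) (n_gt1 : (1 < n)%N) :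
  tofrac (F (radical n)) / tofrac (1 - 'X^(radical n))
    = tofrac (F n) / tofrac (1 - 'X^n) :> {fraction {poly int}}.
Proof.
have n_gt0 := ltnW n_gt1; have r_dvd := radical_dvdn _ n_gt0.
have r_gt0 := dvdn_gt0 n_gt0 r_dvd.
apply/eqP; rewrite eqr_div ?tofrac_eq0 ?oneBXn_neq0 // -!rmorphM /=.
by rewrite (F_cross (radical n)) // => a; apply: coprime_radical.
Qed.
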